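(* Let $A$ and $B$ be uniformly closed function algebras on locally compact Hausdorff spaces $X$ and $Y$, respectively, and let $S(A)$ and $S(B)$ be their unit spheres. If $\Delta\colon S(A)\to S(B)$ is a surjective isometry, then there exists a surjective real linear isometry $T\colon A\to B$ such that $T=\Delta$ on $S(A)$.
   Context: For a locally compact Hausdorff space $X$, $C_0(X)$ denotes the commutative Banach algebra of all continuous complex-valued functions on $X$ vanishing at infinity, with pointwise operations and the supremum norm $\Vert f\Vert=\sup_{x\in X}|f(x)|$. A subset $S\subseteq C_0(X)$ is strongly separating if for each $x\in X$ and all $y,z\in X$ with $y\neq z$ there exist $f,g\in S$ with $f(x)\neq 0$ and $g(y)\neq g(z)$. A uniformly closed function algebra on $X$ is a norm closed, strongly separating (complex) subalgebra of $C_0(X)$. $S(A)=\{f\in A:\Vert f\Vert=1\}$. ''Isometry'' means distance preserving map for the supremum norm distances. *)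

(* Defs.v *)
From mathcomp Require Import all_boot all_order all_algebra.
From mathcomp Require Import all_classical all_reals all_analysis.
From mathcomp Require Import complex.
Import Order.TTheory GRing.Theory Num.Theory.
Import numFieldNormedType.Exports.

Set Implicit Arguments.
Unset Strict Implicit.
Unset Printing Implicit Defensive.

Local Open Scope classical_set_scope.
Local Open Scope ring_scope.
Local Open Scope complex_scope.

(* [R[i]] has a norm valued in [R[i]] (with zero imaginary part), but only the
   regular module [R[i]^o] carries the topology induced by that norm. *)
Definition cabs (R : realType) (z : R[i]) : R := complex.Re `|z|.

Section UniformAlgebras.
Variables (R : realType) (X : topologicalType).
Implicit Types (f g : X -> R[i]^o) (A S : set (X -> R[i]^o)).

Definition C0 : set (X -> R[i]^o) :=
  [set f : X -> R[i]^o | continuous f /\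
           forall e : R, 0 < e -> compact [set x | e <= cabs (f x)]].

(* On [C0] the set below is bounded, so this is a genuine supremum; it is 0
   when X is empty. *)
Definition sup_norm f : R := sup (range (fun x => cabs (f x))).

Definition strongly_separating S : Prop :=
  forall x y z : X, y <> z ->
    exists f g, [/\ S f, S g, f x != 0 & g y != g z].

Definition subalgebra A : Prop :=
  [/\ A (fun=> 0),
      forall f g, A f -> A g -> A (f + g),
      forall (a : R[i]) f, A f -> A (a *: f) &
      forall f g, A f -> A g -> A (f \* g)].

Definition norm_closed A : Prop :=
  forall f, C0 f ->
    (forall e : R, 0 < e -> exists2 g, A g & sup_norm (f - g) < e) -> A f.

Definition uniformly_closed_function_algebra A : Prop :=
  [/\ A `<=` C0, subalgebra A, norm_closed A & strongly_separating A].

Definition unit_sphere A : set (X -> R[i]^o) :=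
  [set f : X -> R[i]^o | A f /\ sup_norm f = 1].

End UniformAlgebras.

Section Maps.
Variables (R : realType) (X Y : topologicalType).
Implicit Types (A : set (X -> R[i]^o)) (T : (X -> R[i]^o) -> (Y -> R[i]^o)).

(* Maps defined on a set A of functions are represented by total maps whose
   values outside A are irrelevant. *)
Definition isometry_on A T : Prop :=
  forall f g, A f -> A g -> sup_norm (T f - T g) = sup_norm (f - g).

Definition real_linear_on A T : Prop :=
  (forall f g, A f -> A g -> T (f + g) = T f + T g) /\
  (forall (r : R) f, A f -> T (r%:C *: f) = r%:C *: T f).

End Maps.

(* Main.v *)
Require Import Defs.
From mathcomp Require Import all_boot all_order all_algebra.
From mathcomp Require Import all_classical all_reals all_analysis.
From mathcomp Require Import complex ring lra.
Import Order.TTheory GRing.Theory Num.Theory.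
Import numFieldNormedType.Exports.

(* Call x a boundary point of A if A contains functions bounded by 1, equal to
   1 at x, and arbitrarily small off any given neighbourhood of x.  Every peak
   set, hence the maximum modulus set of every function of A, meets the set of
   boundary points.  For f, g in the unit sphere, ||f - g|| = 2 iff
   g(x) = -f(x) with |f(x)| = 1 for some x.  So the order "h = f wherever f is
   unimodular on the boundary" is metric, and Delta carries each face
   {f : f(x) = l} of the sphere onto a face {g : g(y) = m}.  Comparing distances
   between faces, y depends only on x, and l |-> m is an isometry of the circle,
   that is, l |-> t l or l |-> t conj(l).  The distances from f to the faces at x
   then determine f(x), so Delta f (y) is t f(x) or t conj(f(x)).  The
   homogeneous extension of Delta inherits this formula, hence is real linear
   and isometric, because boundary points are norming. *)

Set Implicit Arguments.
Unset Strict Implicit.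
Unset Printing Implicit Defensive.

Local Open Scope classical_set_scope.
Local Open Scope ring_scope.
Local Open Scope complex_scope.

(** * Complex modulus *)

Section ComplexModulus.
Variable R : realType.
Implicit Types (z w u p : R[i]).

Lemma cabsC z : (cabs z)%:C = `|z|.
Proof. by rewrite /cabs normc_def. Qed.

Lemma cabs_ge0 z : 0 <= cabs z.
Proof. by rewrite -ler0c cabsC. Qed.

Lemma sqr_cabs z : cabs z ^+ 2 = complex.Re z ^+ 2 + complex.Im z ^+ 2.
Proof. by rewrite /cabs normc_def /= sqr_sqrtr // addr_ge0 ?sqr_ge0. Qed.

Lemma cabs0 : cabs (0 : R[i]) = 0.
Proof. by rewrite /cabs normr0. Qed.

Lemma cabs0_eq0 z : cabs z = 0 -> z = 0.
Proof. by move=> z0; apply: normr0_eq0; rewrite -cabsC z0. Qed.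

Lemma cabsM z w : cabs (z * w) = cabs z * cabs w.
Proof. by apply: (@complexI R); rewrite rmorphM /= !cabsC normrM. Qed.

Lemma cabsD z w : cabs (z + w) <= cabs z + cabs w.
Proof. by rewrite -lecR rmorphD /= !cabsC ler_normD. Qed.

Lemma cabsN z : cabs (- z) = cabs z.
Proof. by rewrite /cabs normrN. Qed.

Lemma cabsB z w : cabs (z - w) = cabs (w - z).
Proof. by rewrite -opprB cabsN. Qed.

Lemma cabs_real (r : R) : cabs r%:C = `|r|.
Proof. by rewrite /cabs normc_def /= expr0n addr0 sqrtr_sqr. Qed.

Lemma cabs1 : cabs (1 : R[i]) = 1.
Proof. by rewrite -[1]/(1%:C) cabs_real normr1. Qed.

Lemma cabsV z : cabs z^-1 = (cabs z)^-1.
Proof.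
exact: ComplexField.Normc.normcV.
Qed.

Lemma cabs_conj z : cabs (conjc z) = cabs z.
Proof. by case: z => a b; rewrite /cabs !normc_def /= sqrrN. Qed.

Lemma conjc0_eq z : z = 0 -> conjc z = 0.
Proof. by move=> ->; exact: conjc0. Qed.

Lemma conjc_realM (r : R) z : conjc (r%:C * z) = r%:C * conjc z.
Proof. by rewrite rmorphM; congr (_ * _); exact: conjc_real. Qed.

Lemma cabs_triangle z w u : cabs (z - w) <= cabs (z - u) + cabs (u - w).
Proof. by apply: le_trans (cabsD _ _); rewrite addrA subrK. Qed.

Lemma cabs_parallelogram z w :
  cabs (z + w) ^+ 2 + cabs (z - w) ^+ 2 = 2 * (cabs z ^+ 2 + cabs w ^+ 2).
Proof.
case: z w => [a b] [c d]; rewrite !sqr_cabs /=; ring.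
Qed.

(** Quantitative strict convexity of the disc: the parallelogram law bounds the left side by
    [4 - (2 - d) ^+ 2]. *)
Lemma cabs_sub_sqr z w (d : R) : cabs z <= 1 -> cabs w <= 1 -> d <= 2 ->
  2 - d <= cabs (z + w) -> cabs (z - w) ^+ 2 <= 4 * d.
Proof.
move=> z1 w1 d2 zw; have := cabs_parallelogram z w.
have := cabs_ge0 z; have := cabs_ge0 w; nra.
Qed.

Lemma cabs_add_eq2 z w : cabs z <= 1 -> cabs w <= 1 -> 2 <= cabs (z + w) ->
  z = w /\ cabs z = 1.
Proof.
move=> z1 w1 zw.
have e : z = w.
  apply: subr0_eq; apply: cabs0_eq0; apply/eqP; rewrite -sqrf_eq0 eq_le sqr_ge0 andbT.
  by rewrite -(mulr0 4) cabs_sub_sqr // subr0.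
split=> //; apply/eqP; rewrite eq_le z1 /=.
by move: zw; have := cabsD z w; rewrite -e; lra.
Qed.

Lemma cabs2V : cabs (2^-1 : R[i]) = 2^-1.
Proof. by rewrite cabsV -(rmorph_nat (real_complex R)) cabs_real ger0_norm. Qed.

Lemma cabs_half z w : cabs z <= 1 -> cabs w <= 1 -> cabs (2^-1 * (z + w)) <= 1.
Proof. by move=> z1 w1; rewrite cabsM cabs2V; have := cabsD z w; lra. Qed.

Lemma cabs_double z : cabs (z + z) = 2 * cabs z.
Proof.
have -> : z + z = 2%:C * z by rewrite rmorph_nat mulr_natl.
by rewrite cabsM cabs_real ger0_norm.
Qed.

Lemma half_addzz z : 2^-1 * (z + z) = z.
Proof. by field. Qed.

Lemma cabs_half_eq1 z w : cabs z <= 1 -> cabs w <= 1 -> 1 <= cabs (2^-1 * (z + w)) ->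
  z = w.
Proof.
move=> z1 w1; rewrite cabsM cabs2V => h.
by have [] // : z = w /\ cabs z = 1 by apply: cabs_add_eq2 => //; lra.
Qed.

Lemma cabsM_le1 z w : cabs z <= 1 -> cabs w <= 1 -> cabs (z * w) <= 1.
Proof. by move=> z1 w1; rewrite cabsM mulr_ile1 ?cabs_ge0. Qed.

(* For [|p| <= 1], [(p + p ^+ 2) / 2] comes close to the unit circle only near [1]. *)
Lemma peak_alignment u : cabs u <= 1 ->
  (forall d : R, 0 < d -> exists2 p, cabs p <= 1 &
     2 - d <= cabs (u + 2^-1 * (p + p ^+ 2))) ->
  u = 1.
Proof.
move=> u1 H; apply: subr0_eq; apply: cabs0_eq0; apply/eqP; rewrite eq_le cabs_ge0 andbT.
apply/ler_addgt0Pr => e e0; rewrite add0r.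
(* The estimates below give [|u - q| <= m] and [|q - 1| <= 2 * m], so [5 * m <= e] leaves room to
   spare. The tolerance [m ^+ 2 / 8] compensates the square root lost in [cabs_sub_sqr]. *)
have [m [m0 me m1]] : exists m : R, [/\ 0 < m, 5 * m <= e & m <= 1].
  exists (Num.min 1 (e / 5)); split.
  - by rewrite lt_min; apply/andP; split; lra.
  - have : Num.min 1 (e / 5) <= e / 5 by rewrite ge_min lexx orbT.
    lra.
  - by rewrite ge_min lexx.
have [p p1] := H (m ^+ 2 / 8) ltac:(nra); set q := 2^-1 * _ => hq.
have q1 : cabs q <= 1 by apply: cabs_half; rewrite // cabsM_le1.
have uq : cabs (u - q) <= m.
  have := @cabs_sub_sqr u q _ u1 q1 _ hq; have := cabs_ge0 (u - q); nra.
have p2 : cabs (1 - p) <= m.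
  have hp : 2 - m ^+ 2 / 4 <= cabs (1 + p).
    have : cabs q <= 2^-1 * cabs (1 + p).
      have -> : q = 2^-1 * (p * (1 + p)) by rewrite /q; ring.
      rewrite !cabsM cabs2V; have := cabs_ge0 (1 + p); have := cabs_ge0 p; nra.
    have := cabsD u q; lra.
  have := @cabs_sub_sqr 1 p _ _ p1 _ hp; rewrite cabs1; have := cabs_ge0 (1 - p); nra.
have q2 : cabs (q - 1) <= 2 * m.
  have -> : q - 1 = - (2^-1 * ((1 - p) * (1 + (1 + p)))) by rewrite /q; field.
  rewrite cabsN !cabsM cabs2V.
  have := cabsD 1 (1 + p); have := cabsD 1 p; rewrite cabs1.
  have := cabs_ge0 (1 - p); have := cabs_ge0 (1 + (1 + p)); nra.
have := cabs_triangle u 1 q; lra.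
Qed.

(** The two squares add up to 4, which exceeds twice the square of [9 / 8]. This threshold is the
    one of [face_corr_far]. *)
Lemma cabs_sub_or_add z w : cabs z = 1 -> cabs w = 1 ->
  9 / 8 < cabs (z - w) \/ 9 / 8 < cabs (z + w).
Proof.
move=> z1 w1; have := cabs_parallelogram z w; rewrite z1 w1 => h.
have [|h1] := ltP (9 / 8) (cabs (z - w)); [by left | right].
have := cabs_ge0 (z - w); have := cabs_ge0 (z + w); nra.
Qed.

Lemma cabsC_neq0 z : z != 0 -> (cabs z)%:C != 0.
Proof. by move=> z0; rewrite cabsC normr_eq0. Qed.

Lemma cabs_unit_part z : z != 0 -> cabs (- (z / (cabs z)%:C)) = 1.
Proof.
move=> z0; rewrite cabsN cabsM cabsV cabs_real ger0_norm ?cabs_ge0 // mulfV //.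
by apply: contra_neq z0; exact: cabs0_eq0.
Qed.

(** The sign is doubled because the value of a function at a point is read off from the face
    labelled by the opposite direction [- (z / |z|)]. *)
Lemma polar_mul z t : z != 0 -> (cabs z)%:C * - (t * - (z / (cabs z)%:C)) = t * z.
Proof. by move=> /cabsC_neq0 z0; rewrite !mulrN opprK mulrCA [_%:C * _]mulrC divfK. Qed.

Lemma polar_mul_conj z t : z != 0 ->
  (cabs z)%:C * - (t * conjc (- (z / (cabs z)%:C))) = t * conjc z.
Proof.
move=> z0; rewrite -(@polar_mul (conjc z) t) ?conjc_eq0 // cabs_conj.
have E : conjc (cabs z)%:C^-1 = (cabs z)%:C^-1 by rewrite conjc_inv conjc_real.
by rewrite rmorphN rmorphM; congr (_ * - (_ * - (_ * _))).
Qed.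

(** After division by [tau 1] the map fixes 1. It preserves real inner products, since these are
    determined by distances on the circle. Pairing with 1 shows that real parts are kept; pairing
    with ['i] shows that imaginary parts are kept up to one global sign. *)
Lemma circle_isometry (tau : R[i] -> R[i]) :
  (forall z, cabs z = 1 -> cabs (tau z) = 1) ->
  (forall z w, cabs z = 1 -> cabs w = 1 -> cabs (tau z - tau w) = cabs (z - w)) ->
  (forall z, cabs z = 1 -> tau z = tau 1 * z) \/
  (forall z, cabs z = 1 -> tau z = tau 1 * conjc z).
Proof.
move=> tau1 tauB.
have t1 : cabs (tau 1) = 1 by rewrite tau1 ?cabs1.
have t0 : tau 1 != 0 by apply/eqP => t0; move: t1; rewrite t0 cabs0; lra.
pose s z := (tau 1)^-1 * tau z.
have s1 z : cabs z = 1 -> cabs (s z) = 1.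
  by move=> z1; rewrite cabsM cabsV t1 tau1 // invr1 mul1r.
have s11 : s 1 = 1 by rewrite /s mulVf.
have sB z w : cabs z = 1 -> cabs w = 1 -> cabs (s z - s w) = cabs (z - w).
  by move=> z1 w1; rewrite -mulrBr cabsM cabsV t1 invr1 mul1r tauB.
suff : (forall z, cabs z = 1 -> s z = z) \/ (forall z, cabs z = 1 -> s z = conjc z).
  by case=> h; [left | right] => z z1;
    rewrite -[LHS](mulVKf t0); congr (_ * _); exact: h.
have ci : cabs ('i : R[i]) = 1 by rewrite /cabs normc_def /= expr0n expr1n add0r sqrtr1.
have sq z : cabs z = 1 -> complex.Re z ^+ 2 + complex.Im z ^+ 2 = 1.
  by move=> z1; rewrite -sqr_cabs z1 expr1n.
have dot z w : cabs z = 1 -> cabs w = 1 ->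
    complex.Re (s z) * complex.Re (s w) + complex.Im (s z) * complex.Im (s w) =
    complex.Re z * complex.Re w + complex.Im z * complex.Im w.
  move=> z1 w1; have /(congr1 (fun x => x ^+ 2)) := sB z w z1 w1.
  have := sq _ (s1 _ z1); have := sq _ (s1 _ w1); have := sq _ z1; have := sq _ w1.
  rewrite !sqr_cabs; clear z1 w1.
  by move: (s z) (s w) => [a b] [c d]; case: z w => [a' b'] [c' d'] /=; nra.
have sre z : cabs z = 1 -> complex.Re (s z) = complex.Re z.
  by move=> z1; have := dot _ _ z1 cabs1; rewrite s11 /= !mulr1 !mulr0 !addr0.
have im z : cabs z = 1 -> complex.Im (s z) * complex.Im (s 'i) = complex.Im z.
  move=> z1; have := dot _ _ z1 ci; rewrite (sre _ ci) /= !mulr0 mulr1 !add0r; exact.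
have := im _ ci; rewrite /= -expr2 => /eqP; rewrite sqrf_eq1 => /orP[] /eqP si.
- left=> z z1; apply/eqP; rewrite eq_complex sre // eqxx /=.
  by rewrite -(im z) // si mulr1.
- right=> z z1; apply/eqP; rewrite eq_complex; have := sre _ z1; have := im _ z1.
  have [-> ->] : complex.Re (conjc z) = complex.Re z /\
      complex.Im (conjc z) = - complex.Im z by case: z {z1}.
  by rewrite si => <- ->; rewrite mulrN1 opprK !eqxx.
Qed.

End ComplexModulus.

(** * Functions vanishing at infinity *)

(** The sets [B i] generate a proper filter, which has a cluster point in [C]. Closures appear
    because some later families, such as sets of boundary points, need not be closed. *)
Lemma compact_directed_closure (T : topologicalType) (C : set T) (I : Type) (i0 : I)
    (B : I -> set T) :
  compact C -> (forall i, B i !=set0) -> (forall i, B i `<=` C) ->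
  (forall i j, exists k, B k `<=` B i `&` B j) ->
  exists2 x, C x & forall i, closure (B i) x.
Proof.
move=> cC B0 BC Bdir.
have FF : ProperFilter (filter_from [set: I] B).
  apply: filter_from_proper; last by move=> i _; exact: B0.
  apply: filter_fromT_filter; first by exists i0.
  by move=> i j; have [k Bk] := Bdir i j; exists k.
have [|x [Cx xB]] := cC _ FF; first by exists i0.
by exists x => // i N xN; apply: xB => //; exists i.
Qed.

Section ContinuousComplexFunctions.
Variables (R : realType) (X : topologicalType).
Implicit Types (f g : X -> R[i]^o).

Lemma continuous_cabsP f : continuous f <->
  forall (x : X) (e : R), 0 < e -> \forall y \near x, cabs (f x - f y) < e.
Proof.
split=> [cf x e e0 | h x].
  have /cvgrPdist_lt/(_ e%:C) := cf x; rewrite ltcR => /(_ e0).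
  by apply: filterS => y; rewrite -cabsC ltcR.
apply/cvgrPdist_lt => e e0.
(* In the order of [R[i]] a positive element has zero imaginary part, so complex radii reduce to
   real ones. *)
have [eI eR] : complex.Im e = 0 /\ 0 < complex.Re e.
  by move: e0; rewrite ltcE /= => /andP[/eqP ? ?].
apply: filterS (h x _ eR) => y; rewrite -ltcR cabsC.
by case: e eI {e0 eR} => a b /= ->.
Qed.

Lemma continuous_cabs f : continuous f -> continuous (fun x => cabs (f x) : R^o).
Proof.
move=> /continuous_cabsP cf x; apply/(@cvgrPdist_lt _ R^o) => e e0.
apply: filterS (cf x e e0) => y; apply: le_lt_trans.
have := cabs_triangle (f x) 0 (f y); have := cabs_triangle (f y) 0 (f x).
rewrite !subr0 (cabsB (f y)) => h1 h2; rewrite ler_norml; apply/andP; split; lra.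
Qed.

Lemma closed_cabs_ge f (e : R) : continuous f -> closed [set x | e <= cabs (f x)].
Proof.
move=> /continuous_cabs cf; apply: (@preimage_closed X R^o _ [set y | e <= y]).
  by move=> x _; exact: cf.
exact: closed_ge.
Qed.

Lemma closed_cabs_le f (e : R) : continuous f -> closed [set x | cabs (f x) <= e].
Proof.
move=> /continuous_cabs cf; apply: (@preimage_closed X R^o _ [set y | y <= e]).
  by move=> x _; exact: cf.
exact: closed_le.
Qed.

Lemma closed_eq_fun f (c : R[i]) : continuous f -> closed [set x | f x = c].
Proof.
move=> cf.
have -> : [set x | f x = c] = [set x | cabs (f x - c) <= 0].
  apply/seteqP; split=> x /=; first by move=> ->; rewrite subrr cabs0.
  by move=> h; apply: subr0_eq; apply: cabs0_eq0; apply/eqP; rewrite eq_le h cabs_ge0.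
apply: (@closed_cabs_le (fun x => f x - c)); apply/continuous_cabsP => x e e0.
move/continuous_cabsP : cf => /(_ x e e0); apply: filterS => y.
by rewrite opprB addrA subrK.
Qed.

(** If [f] has a nonzero value on [K], the part of [K] where [|f|] is at least that large is
    compact, and the maximum is taken there. Otherwise every point of [K] serves. *)
Lemma max_modulus f (K : set X) : C0 f -> closed K -> K !=set0 ->
  exists2 x, K x & forall y, K y -> cabs (f y) <= cabs (f x).
Proof.
move=> [cf fc] clK [x0 Kx0].
have [[x1 [Kx1 fx1]]|h] := pselect (exists x, K x /\ 0 < cabs (f x)); last first.
  exists x0 => // y Ky; apply: le_trans (cabs_ge0 _); rewrite leNgt; apply/negP => fy.
  by apply: h; exists y.
pose C := K `&` [set x | cabs (f x1) <= cabs (f x)].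
have cC : compact C.
  apply: (subclosed_compact _ (fc _ fx1)) => [|x []//].
  by apply: closedI => //; exact: closed_cabs_ge.
have C0 : C !=set0 by exists x1; split => //=.
have [x /set_mem[Kx /= x1x] hx] :=
  compact_EVT_max C0 cC (continuous_subspaceT (continuous_cabs cf)).
exists x => // y Ky; have [yx1|yx1] := leP (cabs (f x1)) (cabs (f y)).
  by apply: hx; apply/mem_set.
exact: le_trans (ltW yx1) x1x.
Qed.

Lemma le_sup_norm f x : C0 f -> cabs (f x) <= sup_norm f.
Proof.
move=> fC; apply: ub_le_sup; last by exists x.
have [y _ hy] := max_modulus fC closedT (ex_intro _ x I).
by exists (cabs (f y)) => _ [z _ <-]; exact: hy.
Qed.

Lemma sup_norm_le f (M : R) : 0 <= M -> (forall x, cabs (f x) <= M) -> sup_norm f <= M.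
Proof.
move=> M0 fM; have [h|h] := pselect (range (fun x => cabs (f x)) !=set0).
  by apply: ge_sup => // _ [x _ <-].
rewrite /sup_norm; have -> : range (fun x => cabs (f x)) = set0.
  by apply/seteqP; split => // y hy; apply: h; exists y.
by rewrite sup0.
Qed.

Lemma sup_norm_ge0 f : C0 f -> 0 <= sup_norm f.
Proof.
move=> fC; have [[x _]|h] := pselect ([set: X] !=set0).
  exact: le_trans (cabs_ge0 _) (le_sup_norm x fC).
rewrite /sup_norm; have -> : range (fun x => cabs (f x)) = set0.
  by apply/seteqP; split => // y [x _ _]; apply: h; exists x.
by rewrite sup0.
Qed.

Lemma sup_norm_attained f : C0 f -> 0 < sup_norm f ->
  exists x, cabs (f x) = sup_norm f.
Proof.
move=> fC f0; have [[x0 _]|h] := pselect ([set: X] !=set0).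
  have [x _ hx] := max_modulus fC closedT (ex_intro _ x0 I).
  exists x; apply/eqP; rewrite eq_le le_sup_norm //= sup_norm_le ?cabs_ge0 //.
  by move=> y; exact: hx.
move: f0; rewrite ltNge; case/negP; apply: sup_norm_le => // x.
by case: h; exists x.
Qed.

Lemma sup_norm_eq f (M : R) x : C0 f -> (forall y, cabs (f y) <= M) ->
  cabs (f x) = M -> sup_norm f = M.
Proof.
move=> fC fM fx; apply/eqP; rewrite eq_le -{2}fx le_sup_norm // andbT.
by apply: sup_norm_le => //; rewrite -fx cabs_ge0.
Qed.

Lemma C0_uniform_limit f :
  (forall e : R, 0 < e -> exists2 g, C0 g & forall x, cabs (f x - g x) <= e) -> C0 f.
Proof.
move=> H; have cf : continuous f.
  apply/continuous_cabsP => x e e0.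
  have [g [/continuous_cabsP cg _] fg] := H (e / 4) ltac:(lra).
  have := cg x (e / 4) ltac:(lra); apply: filterS => y gxy.
  have := cabs_triangle (f x) (f y) (g x); have := cabs_triangle (g x) (f y) (g y).
  have := fg x; have := fg y; rewrite (cabsB (f y)); lra.
split=> // e e0; have [g [_ gc] fg] := H (e / 2) ltac:(lra).
apply: (subclosed_compact (closed_cabs_ge cf) (gc (e / 2) ltac:(lra))) => x /= fx.
have := cabs_triangle (f x) 0 (g x); have := fg x; rewrite !subr0; lra.
Qed.

End ContinuousComplexFunctions.

(** * Peaking functions *)

Section GeometricLimits.
Variable R : realType.

Lemma expr_lt_eps (t e : R) : 0 <= t -> t < 1 -> 0 < e -> exists n, t ^+ n < e.
Proof.
move=> t0 t1 e0.
have /cvgrPdist_lt/(_ e e0) : (fun n => t ^+ n : R^o) @ \oo --> (0 : R^o).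
  by apply: cvg_expr; rewrite ger0_norm.
move=> [n _ /(_ n (leqnn n))] /=; rewrite sub0r normrN => h.
by exists n; apply: le_lt_trans h; exact: ler_norm.
Qed.

Lemma mul_half_expr_lt_eps (M e : R) : 0 <= M -> 0 < e -> exists n, M * 2^-1 ^+ n < e.
Proof.
move=> M0 e0.
have [n hn] := @expr_lt_eps 2^-1 (e / (M + 1)) ltac:(lra) ltac:(lra) ltac:(apply: divr_gt0; lra).
exists n; have M1 : 0 < M + 1 by lra.
move: hn; rewrite ltr_pdivlMr // => hn.
have : 0 <= 2^-1 ^+ n :> R by apply: exprn_ge0; lra.
nra.
Qed.

Lemma le0_half_expr (M a : R) : 0 <= M -> (forall n, a <= M * 2^-1 ^+ n) -> a <= 0.
Proof.
move=> M0 aM; rewrite leNgt; apply/negP => a0.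
have [n hn] := mul_half_expr_lt_eps M0 a0.
by have := aM n; rewrite leNgt hn.
Qed.

(** The intervals of radius [M * 2^-1 ^+ n] around [v n] are nested, so the supremum of their left
    ends lies in all of them. *)
Lemma real_geometric_limit (v : nat -> R) (M : R) :
  (forall n, `|v n.+1 - v n| <= M * 2^-1 ^+ n.+1) ->
  exists l, forall n, `|v n - l| <= M * 2^-1 ^+ n.
Proof.
move=> vM; pose w n := v n - M * 2^-1 ^+ n; pose z n := v n + M * 2^-1 ^+ n.
have half n : 2^-1 ^+ n = 2 * 2^-1 ^+ n.+1 :> R by rewrite exprS mulrA mulfV ?mul1r.
have wS n : w n <= w n.+1.
  by have := vM n; rewrite /w (half n) ler_norml => /andP[]; lra.
have zS n : z n.+1 <= z n.
  by have := vM n; rewrite /z (half n) ler_norml => /andP[]; lra.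
have wmono : {homo w : m n / (m <= n)%N >-> m <= n} by apply/nondecreasing_seqP.
have zmono : {homo z : m n / (m <= n)%N >-> n <= m} by apply/nonincreasing_seqP.
have M0 n : 0 <= M * 2^-1 ^+ n.+1 by apply: le_trans (vM n).
have wz m n : w m <= z n.
  apply: le_trans (wmono _ _ (leq_maxl m n)) _.
  apply: le_trans (zmono _ _ (leq_maxr m n)).
  by rewrite /w /z (half (maxn m n)); have := M0 (maxn m n); lra.
exists (sup (range w)) => n.
have wl : w n <= sup (range w).
  apply: ub_le_sup; last by exists n.
  by exists (z 0%N) => _ [m _ <-].
have lz : sup (range w) <= z n by apply: ge_sup; [exists (w 0%N), 0%N | move=> _ [m _ <-]].
by move: wl lz; rewrite /w /z ler_norml => ? ?; apply/andP; split; lra.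
Qed.

Lemma complex_geometric_limit (u : nat -> R[i]) (M : R) :
  (forall n, cabs (u n.+1 - u n) <= M * 2^-1 ^+ n.+1) ->
  exists l, forall n, cabs (u n - l) <= (2 * M) * 2^-1 ^+ n.
Proof.
move=> uM.
have reim (z : R[i]) : [/\ `|complex.Re z| <= cabs z, `|complex.Im z| <= cabs z &
    cabs z <= `|complex.Re z| + `|complex.Im z|].
  have s := sqr_cabs z; have c0 := cabs_ge0 z.
  have r0 := normr_ge0 (complex.Re z); have i0 := normr_ge0 (complex.Im z).
  have := real_normK (num_real (complex.Re z)); have := real_normK (num_real (complex.Im z)).
  move=> hi hr; split; nra.
have ReB (z w : R[i]) : complex.Re (z - w) = complex.Re z - complex.Re w.
  by case: z w => [a b] [c d].
have ImB (z w : R[i]) : complex.Im (z - w) = complex.Im z - complex.Im w.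
  by case: z w => [a b] [c d].
have [a ha] : exists l, forall n, `|complex.Re (u n) - l| <= M * 2^-1 ^+ n.
  apply: real_geometric_limit => n; apply: le_trans (uM n).
  by rewrite -ReB; case: (reim (u n.+1 - u n)).
have [b hb] : exists l, forall n, `|complex.Im (u n) - l| <= M * 2^-1 ^+ n.
  apply: real_geometric_limit => n; apply: le_trans (uM n).
  by rewrite -ImB; case: (reim (u n.+1 - u n)).
exists (a +i* b) => n; have [_ _] := reim (u n - (a +i* b)).
by rewrite ReB ImB /=; have := ha n; have := hb n; lra.
Qed.

End GeometricLimits.

(** * Peaking and extension in a uniformly closed function algebra *)

Section FunctionAlgebras.
Variables (R : realType) (X : topologicalType) (A : set (X -> R[i]^o)).
Implicit Types (f g h p : X -> R[i]^o) (K : set X).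

Definition unit_ball : set (X -> R[i]^o) := [set p | A p /\ forall x, cabs (p x) <= 1].

Definition peaking_on K : set (X -> R[i]^o) :=
  [set h | unit_ball h /\ forall x, K x -> h x = 1].

Hypothesis algA : uniformly_closed_function_algebra A.

Lemma algebra_C0 f : A f -> C0 f.
Proof. by case: algA => h _ _ _; exact: h. Qed.

Lemma algebra0 : A (fun=> 0).
Proof. by case: algA => _ []. Qed.

Lemma algebraD f g : A f -> A g -> A (f + g).
Proof. by case: algA => _ [] _ h _ _ _ _; exact: h. Qed.

Lemma algebraZ (a : R[i]) f : A f -> A (a *: f).
Proof. by case: algA => _ [] _ _ h _ _ _; exact: h. Qed.

Lemma algebraM f g : A f -> A g -> A (f \* g).
Proof. by case: algA => _ [] _ _ _ h _ _; exact: h. Qed.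

Lemma algebraB f g : A f -> A g -> A (f - g).
Proof. by move=> Af Ag; rewrite -scaleN1r; apply: algebraD => //; exact: algebraZ. Qed.

Lemma algebra_continuous f : A f -> continuous f.
Proof. by move/algebra_C0 => []. Qed.

Lemma peakingM K h p : peaking_on K h -> peaking_on K p -> peaking_on K (h \* p).
Proof.
move=> [[Ah h1] hK] [[Ap p1] pK]; split; first split.
- exact: algebraM.
- by move=> x; apply: cabsM_le1.
- by move=> x Kx /=; rewrite hK // pK // mulr1.
Qed.

(** The classical [(1 + p) / 2] requires constants in the algebra; its product with [p] does not,
    and still has modulus 1 only where [p] equals 1. *)
Definition sharpen p : X -> R[i]^o := 2^-1 *: (p + p \* p).

Lemma unit_ball_sharpen p : unit_ball p -> unit_ball (sharpen p).
Proof.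
move=> [Ap p1]; split; first by apply: algebraZ; apply: algebraD => //; exact: algebraM.
by move=> x; apply: cabs_half => //; apply: cabsM_le1.
Qed.

Lemma sharpen_eq1 p x : p x = 1 -> sharpen p x = 1.
Proof. by move=> px; rewrite /sharpen /= !fctE /= px mulr1; apply: mulVf. Qed.

(** By strict convexity, modulus 1 of the average forces [p x = p x ^+ 2] with [p x] nonzero. *)
Lemma cabs_sharpen_lt1 p x : cabs (p x) <= 1 -> p x != 1 -> cabs (sharpen p x) < 1.
Proof.
move=> p1; apply: contra_neqT; rewrite -leNgt => h.
have e : p x = p x * p x by apply: cabs_half_eq1 => //; apply: cabsM_le1.
have p0 : p x != 0.
  apply/eqP => p0; move: h; rewrite /sharpen /= !fctE /= p0 mulr0 addr0.
  by rewrite /GRing.scale /= mulr0 cabs0; lra.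
by apply: (mulfI p0); rewrite mulr1 -e.
Qed.

(** If every peaking [h] reached [e] somewhere on [C], the sets where this happens would be
    directed, because a product is at most either factor in modulus. Compactness yields a point of
    [C] at which all of them reach [e], against high powers of a function separating that point from
    [K]. *)
Lemma peaking_small K (C : set X) p0 (e : R) :
  peaking_on K p0 -> compact C ->
  (forall y, C y -> exists2 p, peaking_on K p & p y != 1) -> 0 < e ->
  exists2 h, peaking_on K h & forall y, C y -> cabs (h y) < e.
Proof.
move=> p0K cC sepC e0; apply: contrapT => hC.
pose B (h : {h | peaking_on K h}) := C `&` [set y | e <= cabs (sval h y)].
have [|||x Cx hx] := @compact_directed_closure _ C _ (exist _ p0 p0K) B cC.
- move=> [h hK]; apply: contrapT => B0; apply: hC; exists h => // y Cy.
  by rewrite ltNge; apply/negP => hy; apply: B0; exists y.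
- by move=> h x [].
- move=> [h hK] [p pK]; exists (exist _ _ (peakingM hK pK)) => x [Cx /= hx].
  move: hx; rewrite cabsM => hx; have := cabs_ge0 (h x); have := cabs_ge0 (p x).
  have [[_ h1] _] := hK; have [[_ p1] _] := pK; have := h1 x; have := p1 x.
  by move=> *; split; split=> //=; nra.
have {}hx h : peaking_on K h -> e <= cabs (h x).
  move=> hK; apply: (closed_cabs_ge (algebra_continuous hK.1.1)).
  by apply: closure_subset (hx (exist _ h hK)) => y [].
have [p pK px] := sepC x Cx.
(* The value [p x] may be another unimodular number, whose powers do not decay; sharpening brings
   the modulus below 1. *)
pose q := sharpen p.
have qK : peaking_on K q.
  case: pK => pb pK; split; first exact: unit_ball_sharpen.
  by move=> y Ky; apply: sharpen_eq1; exact: pK.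
have q1 : cabs (q x) < 1 by apply: cabs_sharpen_lt1 => //; case: pK => -[].
have [n hn] := expr_lt_eps (cabs_ge0 _) q1 e0.
have [h hK hq] : exists2 h, peaking_on K h & cabs (h x) = cabs (q x) ^+ n.+1.
  elim: n {hn} => [|n [h hK hE]]; first by exists q; rewrite ?expr1.
  by exists (q \* h); [exact: peakingM | rewrite /= cabsM hE [RHS]exprS].
have := hx h hK; rewrite hq exprS.
have : 0 <= cabs (q x) ^+ n by rewrite exprn_ge0 ?cabs_ge0.
have := cabs_ge0 (q x); nra.
Qed.

(* [g] is the limit of [G n], with [|G n| < 1] everywhere and
   [G n = (1 - 2 ^- n) f] on [K]; the next term is [G n + 2 ^- n.+1 f h], where
   [h] peaks on [K] and is small on the compact set, disjoint from [K], where
   [|G n| + 2 ^- n.+1 |f| >= 1]. *)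
Lemma peaking_extension K p0 f :
  peaking_on K p0 -> (forall y, (forall p, peaking_on K p -> p y = 1) -> K y) ->
  A f -> (forall x, K x -> cabs (f x) <= 1) ->
  exists2 g, unit_ball g & forall x, K x -> g x = f x.
Proof.
move=> p0K hullK Af f1.
pose M := sup_norm f + 1.
have fC := algebra_C0 Af; have f0 := sup_norm_ge0 fC.
have fM x : cabs (f x) <= M by have := le_sup_norm x fC; rewrite /M; lra.
have M1 : 1 <= M by rewrite /M; lra.
pose approx n G := [/\ A G, forall x, cabs (G x) < 1 &
  forall x, K x -> G x = (1 - 2^-1 ^+ n)%:C * f x].
(* The existential precedes the implication so that [choice] produces a total successor function. *)
have step (nG : nat * (X -> R[i]^o)) : exists G', approx nG.1 nG.2 ->
    approx nG.1.+1 G' /\ forall x, cabs (G' x - nG.2 x) <= M * 2^-1 ^+ nG.1.+1.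
  case: nG => n G /=; have [[AG G1 GK]|] := pselect (approx n G); last by move=> h; exists G.
  set t : R := 2^-1 ^+ n.+1.
  have t0 : 0 < t by rewrite /t; apply: exprn_gt0; lra.
  have tn : 2^-1 ^+ n = 2 * t by rewrite /t exprS mulrA mulfV ?mul1r.
  have t1 : 2 * t <= 1 by rewrite -tn; apply: exprn_ile1; lra.
  have GC := algebra_C0 AG.
  have m1 : sup_norm G < 1.
    have [m0|m0] := ltP 0 (sup_norm G); last by lra.
    by have [x <-] := sup_norm_attained GC m0.
  have [cG GC'] := GC; have [cf fC'] := fC.
  (* On [C] one of [|G|], [|f|] is at least [1 / 2], whence compactness. On [K] the sum is at most
     [1 - t], so [C] misses [K]. *)
  pose C := [set x | 1 <= cabs (G x) + t * cabs (f x)].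
  have cC : compact C.
    apply: (@subclosed_compact _ _ ([set x | 2^-1 <= cabs (G x)] `|` [set x | 2^-1 <= cabs (f x)])).
    - apply: (@preimage_closed X R^o (fun x => cabs (G x) + t * cabs (f x)) [set y | 1 <= y]).
        move=> x _; apply: (@cvgD _ R^o); first exact: continuous_cabs.
        by apply: (@cvgM R); [exact: cvg_cst | exact: (continuous_cabs cf)].
      exact: closed_ge.
    - by apply: compactU; [apply: GC' | apply: fC']; lra.
    - move=> x /= h; have [|h1] := leP 2^-1 (cabs (G x)); [by left | right => /=].
      have : t * cabs (f x) <= cabs (f x) by rewrite ler_piMl ?cabs_ge0 //; lra.
      by move: h h1; rewrite /C /=; lra.
  (* With this bound the correction [t * f * h] stays below [(1 - sup_norm G) / 2] on [C], which
     keeps the next term under 1 in modulus. *)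
  have [||h hK hC] := @peaking_small K C p0 ((1 - sup_norm G) / (2 * M)) p0K cC.
  - move=> y Cy; apply: contrapT => hy; have Ky : K y.
      by apply: hullK => p pK; apply/eqP; apply: contrapT => /negP py; apply: hy; exists p.
    move: Cy; rewrite /C /= GK // cabsM cabs_real tn ger0_norm; last lra.
    have := f1 y Ky; have := cabs_ge0 (f y); nra.
  - by apply: divr_gt0; lra.
  exists (G + t%:C *: (f \* h)) => _; have [[Ah h1] hK1] := hK.
  have ct : cabs (t%:C) = t by rewrite cabs_real ger0_norm // ltW.
  split; last first.
    move=> x; have -> : (G + t%:C *: (f \* h)) x - G x = t%:C * (f x * h x).
      by rewrite !fctE /= addrAC subrr add0r.
    rewrite !cabsM ct mulrC; apply: ler_wpM2r; first exact: ltW.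
    have := fM x; have := h1 x; have := cabs_ge0 (f x); have := cabs_ge0 (h x); nra.
  split.
  - by apply: algebraD => //; apply: algebraZ; apply: algebraM.
  - move=> x; rewrite fctE /= fctE.
    have := cabsD (G x) (t%:C * (f x * h x)); rewrite !cabsM ct => le1.
    apply: le_lt_trans le1 _.
    have f0x := cabs_ge0 (f x); have h0x := cabs_ge0 (h x); have h1x := h1 x; have fMx := fM x.
    have [Cx|Cx] := leP 1 (cabs (G x) + t * cabs (f x)); last first.
      have : cabs (f x) * cabs (h x) <= cabs (f x) by rewrite ler_piMr.
      by nra.
    have := hC x Cx; rewrite ltr_pdivlMr; last by lra.
    have : cabs (f x) * cabs (h x) <= M * cabs (h x) by rewrite ler_wpM2r.
    have : t * (cabs (f x) * cabs (h x)) <= cabs (f x) * cabs (h x).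
      by rewrite ler_piMl ?mulr_ge0 //; lra.
    by have := le_sup_norm x GC; lra.
  - move=> x Kx; have -> : (G + t%:C *: (f \* h)) x = G x + t%:C * (f x * h x) by [].
    rewrite hK1 // mulr1 GK // tn.
    by rewrite -mulrDl -rmorphD /=; congr (_%:C * _); rewrite /t; lra.
have [next nextP] := choice step.
pose G := fix G n := if n is m.+1 then next (m, G m) else (fun=> 0) : X -> R[i]^o.
have GP n : approx n (G n).
  elim: n => [|n IH]; last by have [] := nextP (n, G n) IH.
  split; [exact: algebra0 | by move=> x; rewrite /= cabs0 | ].
  by move=> x _; rewrite /= expr0 subrr mul0r.
have [g gP] := choice (fun x => @complex_geometric_limit R (fun n => G n x) M
  (fun n => (nextP (n, G n) (GP n)).2 x)).
have Mh n : 0 <= 2 * M * 2^-1 ^+ n by apply: mulr_ge0; [lra | apply: exprn_ge0; lra].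
have gC : C0 (g : X -> R[i]^o).
  apply: C0_uniform_limit => e e0.
  have [n hn] := @mul_half_expr_lt_eps _ (2 * M) e ltac:(lra) e0.
  exists (G n); first by apply: algebra_C0; case: (GP n).
  by move=> x; rewrite cabsB; apply: le_trans (gP x n) _; exact: ltW.
exists g; first split.
- case: algA => _ _ clA _; apply: clA => // e e0.
  have [n hn] := @mul_half_expr_lt_eps _ (2 * M) e ltac:(lra) e0.
  exists (G n); first by case: (GP n).
  apply: le_lt_trans hn; apply: sup_norm_le => // x.
  by rewrite !fctE cabsB.
- move=> x; rewrite -subr_le0; apply: (@le0_half_expr _ (2 * M)); first lra.
  move=> n; have := gP x n; have [_ /(_ x) G1 _] := GP n.
  by have := cabs_triangle (g x) 0 (G n x); rewrite !subr0 cabsB; lra.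
- move=> x Kx; apply: subr0_eq; apply: cabs0_eq0; apply/eqP; rewrite eq_le cabs_ge0 andbT.
  apply: (@le0_half_expr _ (2 * M + 1)); first lra.
  move=> n; have := gP x n; have [_ _ /(_ x Kx) GK] := GP n.
  have := cabs_triangle (g x) (f x) (G n x); rewrite (cabsB (g x) (G n x)).
  have -> : G n x - f x = - ((2^-1 ^+ n)%:C * f x).
    by rewrite GK rmorphB rmorph1 mulrBl mul1r addrAC subrr sub0r.
  have h0 : 0 <= 2^-1 ^+ n :> R by apply: exprn_ge0; lra.
  rewrite cabsN cabsM cabs_real ger0_norm //.
  have := f1 x Kx; have := cabs_ge0 (f x); nra.
Qed.

End FunctionAlgebras.

(** * Boundary points *)

Section BoundaryPoints.
Variables (R : realType) (X : topologicalType) (A : set (X -> R[i]^o)).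
Hypothesis algA : uniformly_closed_function_algebra A.
Implicit Types (f g h p : X -> R[i]^o) (K : set X).

(** These are the strong boundary points of [A]. *)
Definition boundary_pt (x : X) := forall V, nbhs x V -> forall e : R, 0 < e ->
  exists2 p, unit_ball A p /\ p x = 1 & forall y, ~ V y -> cabs (p y) < e.

Definition peak_set (S : set (X -> R[i]^o)) : set X :=
  [set x | forall p, S p -> p x = 1].

Lemma closed_peak_set S : S `<=` A -> closed (peak_set S).
Proof.
move=> SA x clx p Sp.
apply: (@closed_eq_fun _ _ _ 1 (algebra_continuous algA (SA _ Sp)) x).
by apply: closure_subset clx => y; exact.
Qed.

(** Zorn's lemma is applied to the families of functions: a larger family has a smaller peak set.
    The peak sets along a chain lie in the compact set where [|p0| >= 1], so their intersection is
    not empty. A function equal to 1 somewhere on the final peak set could be added to the family,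
    hence already belongs to it. *)
Lemma peak_set_minimal (S : set (X -> R[i]^o)) p0 x0 :
  S `<=` unit_ball A -> S p0 -> peak_set S x0 ->
  exists M, [/\ M `<=` unit_ball A, S `<=` M, peak_set M !=set0 &
    forall g, unit_ball A g -> peak_set M `&` [set x | g x = 1] !=set0 -> M g].
Proof.
move=> SA Sp0 Sx0.
(* The union with [S] makes the empty chain admissible, its peak set being that of [S]. *)
pose P (M : set (X -> R[i]^o)) := M `<=` unit_ball A /\ peak_set (M `|` S) !=set0.
have [F FP Ftot|M [[MA [x Mx]] Mmax]] := @Zorn_bigcup _ P.
  split; first by move=> p [M FM Mp]; exact: (FP _ FM).1.
  have [[M0 FM0]|F0] := pselect (F !=set0); last first.
    by exists x0 => p [[M FM]|/Sx0 //]; case: F0; exists M.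
  have cC : compact [set x | 1 <= cabs (p0 x)].
    by have [_ h] := algebra_C0 algA (SA _ Sp0).1; exact: h.
  pose B (M : {M | F M}) := peak_set (sval M `|` S).
  have [|||x _ xB] := @compact_directed_closure _ _ _ (exist _ M0 FM0) B cC.
  - by move=> [M FM]; exact: (FP _ FM).2.
  - by move=> M x /(_ p0 (or_intror Sp0)) /= ->; rewrite cabs1.
  - move=> [M FM] [N FN]; have [MN|NM] := Ftot _ _ FM FN.
      exists (exist _ N FN) => x xN; split=> p [] ?; apply: xN; [|by right|by left|by right].
      by left; exact: MN.
    exists (exist _ M FM) => x xN; split=> p [] ?; apply: xN; [by left|by right| |by right].
    by left; exact: NM.
  have {}xB M p : F M -> (M `|` S) p -> p x = 1.
    move=> FM; have MSA : M `|` S `<=` A by move=> q [/(FP _ FM).1 []|/SA[]].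
    exact: (closed_peak_set MSA (xB (exist _ M FM))).
  exists x => p [[M FM Mp]|Sp]; first by apply: (xB _ _ FM); left.
  by apply: (xB _ _ FM0); right.
exists (M `|` S); split=> //.
- by move=> p [/MA|/SA].
- by exists x.
- move=> g gA [y [My gy]]; left; apply: contrapT => Mg.
  apply: (Mmax (M `|` [set g])); first split.
  + by move=> p; left.
  + by move=> h; apply: Mg; apply: h; right.
  + split; first by move=> p [/MA|->].
    by exists y => p [[Mp| ->]|Sp] //; apply: My; [left|right].
Qed.

(* Every [f] in [A] is constant on a minimal peak set: otherwise the extension of
   [f / max |f|] would cut out a smaller one.  So it is a single point, as [A]
   separates points. *)
Lemma peak_set_boundary (S : set (X -> R[i]^o)) p0 x0 :
  S `<=` unit_ball A -> S p0 -> peak_set S x0 ->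
  exists2 x, boundary_pt x & peak_set S x.
Proof.
move=> SA Sp0 Sx0.
have [M [MA SM [x Mx] Mmax]] := peak_set_minimal SA Sp0 Sx0.
have MK p : M p -> peaking_on A (peak_set M) p.
  by move=> Mp; split; [exact: MA | move=> y; exact].
have hullM y : (forall p, peaking_on A (peak_set M) p -> p y = 1) -> peak_set M y.
  by move=> h p Mp; apply: h; exact: MK.
have Mconst f y : A f -> peak_set M y -> f y = f x.
  move=> Af My.
  have MA' : M `<=` A by move=> p /MA[].
  have [x2 Mx2 hx2] := max_modulus (algebra_C0 algA Af) (closed_peak_set MA') (ex_intro _ x Mx).
  have [f0|f0] := eqVneq (f x2) 0.
    have fz z : peak_set M z -> f z = 0.
      move=> Mz; apply: cabs0_eq0; apply/eqP; rewrite eq_le cabs_ge0 andbT.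
      by have := hx2 z Mz; rewrite f0 cabs0.
    by rewrite !fz.
  have c0 : 0 < cabs (f x2).
    by rewrite lt_neqAle cabs_ge0 andbT eq_sym; apply: contra_neq f0; exact: cabs0_eq0.
  have [||g gA gf] := @peaking_extension _ _ _ algA _ _ ((f x2)^-1 *: f) (MK _ (SM _ Sp0)) hullM.
  - exact: algebraZ.
  - move=> z Mz; have -> : ((f x2)^-1 *: f) z = (f x2)^-1 * f z by [].
    by rewrite cabsM cabsV mulrC ler_pdivrMr // mul1r hx2.
  (* Since [g x2 = 1], maximality makes [g] a member of [M]; thus [g], which is [f / f x2] on the
     peak set, equals 1 on all of it. *)
  have Mg : M g.
    by apply: Mmax => //; exists x2; split=> //=; rewrite gf //; exact: mulVf.
  have fx2 z : peak_set M z -> f z = f x2.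
    move=> Mz; have := gf z Mz; rewrite (Mz _ Mg) => h.
    by rewrite -[LHS](mulVKf f0) -[_^-1 * _]h mulr1.
  by rewrite !fx2.
have Mpt y : peak_set M y -> y = x.
  move=> My; apply: contrapT => yx; have [_ _ _ sepA] := algA.
  by have [_ [g [_ Ag _ /eqP]]] := sepA x y x yx; apply; exact: Mconst.
exists x; last by move=> p /SM; exact: Mx.
move=> V xV e e0.
(* The complement of [V] need not be compact. Only its part with [|p0| >= e] is left to [h];
   elsewhere the factor [p0] of the final product is small by itself. *)
have cC : compact ([set y | e <= cabs (p0 y)] `&` ~` V^°).
  apply: (@subclosed_compact _ _ [set y | e <= cabs (p0 y)]); last by move=> y [].
    apply: closedI; first by apply: closed_cabs_ge; exact: algebra_continuous (SA _ Sp0).1.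
    by apply: open_closedC; exact: open_interior.
  by have [_ h] := algebra_C0 algA (SA _ Sp0).1; exact: h.
have [|h hK hC] := peaking_small algA (MK _ (SM _ Sp0)) cC _ e0.
  move=> y [_ Vy]; apply: contrapT => hy; apply: Vy; rewrite (Mpt y) //.
  move=> p Mp; apply/eqP; apply: contrapT => /negP py; apply: hy.
  by exists p => //; exact: MK.
have [[Ap01 p01] p0K] := MK _ (SM _ Sp0); have [[Ah h1] h1K] := hK.
exists (h \* p0); first by have [] := peakingM algA hK (MK _ (SM _ Sp0)) => ? ->.
move=> y Vy; rewrite cabsM.
have := h1 y; have := p01 y; have := cabs_ge0 (h y); have := cabs_ge0 (p0 y).
have [Cy|Cy] := leP e (cabs (p0 y)); last by nra.
have : cabs (h y) < e by apply: hC; split=> // /interior_subset.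
nra.
Qed.

(** Divided by its value at a maximum point, [f] lies in the unit ball and equals 1 there, so its
    peak set contains a boundary point. *)
Lemma norm_attained_boundary f : A f -> 0 < sup_norm f ->
  exists2 x, boundary_pt x & cabs (f x) = sup_norm f.
Proof.
move=> Af f0; have [x0 fx0] := sup_norm_attained (algebra_C0 algA Af) f0.
have fx00 : f x0 != 0 by apply/eqP => h; move: f0; rewrite -fx0 h cabs0 ltxx.
pose p := (f x0)^-1 *: f.
have [|//||x bx px] := @peak_set_boundary [set p] p x0.
- move=> _ ->; split; first exact: algebraZ.
  move=> y; have -> : p y = (f x0)^-1 * f y by [].
  rewrite cabsM cabsV fx0 mulrC ler_pdivrMr // mul1r.
  exact: le_sup_norm (algebra_C0 algA Af).
- by move=> _ ->; exact: mulVf.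
exists x => //; rewrite -fx0; congr cabs.
have h : (f x0)^-1 * f x = 1 := px p erefl.
by rewrite -[LHS](mulVKf fx00) h mulr1.
Qed.

Lemma eq_on_boundary f g : A f -> A g -> (forall x, boundary_pt x -> f x = g x) -> f = g.
Proof.
move=> Af Ag fg; apply/funext => x; apply: subr0_eq; apply: cabs0_eq0.
have Afg := algebraB algA Af Ag.
have [h|h] := ltP 0 (sup_norm (f - g)).
  have [y by_ fgy] := norm_attained_boundary Afg h.
  by move: h; rewrite -fgy !fctE fg // subrr cabs0 ltxx.
apply/eqP; rewrite eq_le cabs_ge0 andbT; apply: le_trans h.
exact: (le_sup_norm x (algebra_C0 algA Afg)).
Qed.

End BoundaryPoints.

(** * Faces of the unit sphere *)

Section UnitSphere.
Variables (R : realType) (X : topologicalType) (A : set (X -> R[i]^o)).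
Hypothesis algA : uniformly_closed_function_algebra A.
Implicit Types (f g h p : X -> R[i]^o).

Lemma sphere_le1 f x : unit_sphere A f -> cabs (f x) <= 1.
Proof. by move=> [Af <-]; apply: le_sup_norm; exact: algebra_C0 Af. Qed.

Lemma sphere_intro f x : A f -> (forall y, cabs (f y) <= 1) -> cabs (f x) = 1 ->
  unit_sphere A f.
Proof. by move=> Af f1 fx; split=> //; apply: (sup_norm_eq (algebra_C0 algA Af)) fx. Qed.

Lemma sphere_scale_peak (l : R[i]) p x : cabs l = 1 -> unit_ball A p -> p x = 1 ->
  unit_sphere A (l *: p).
Proof.
move=> l1 [Ap p1] px; apply: (@sphere_intro _ x); first exact: algebraZ.
- by move=> y; rewrite fctE cabsM l1 mul1r.
- by rewrite fctE cabsM l1 mul1r px cabs1.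
Qed.

(** The norm of [f - g] is attained, and equality in the triangle inequality on the disc forces
    opposite unimodular values. *)
Lemma sphere_dist_eq2P f g : unit_sphere A f -> unit_sphere A g ->
  sup_norm (f - g) = 2 <-> exists x, cabs (f x) = 1 /\ g x = - f x.
Proof.
move=> Sf Sg; have fgC := algebra_C0 algA (algebraB algA Sf.1 Sg.1); split.
  move=> fg2; have [x] := @sup_norm_attained _ _ _ fgC ltac:(rewrite fg2; lra).
  rewrite fg2 => fgx; exists x.
  have [||e ->] := @cabs_add_eq2 _ (f x) (- g x) (sphere_le1 _ Sf); rewrite ?cabsN.
  - exact: sphere_le1.
  - by rewrite -fgx.
  - by rewrite e opprK.
move=> [x [fx gx]]; apply: (@sup_norm_eq _ _ _ _ x fgC).
  move=> y; have := cabsD (f y) (- g y); rewrite cabsN.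
  by have := sphere_le1 y Sf; have := sphere_le1 y Sg; rewrite !fctE; lra.
by rewrite !fctE gx opprK cabs_double fx mulr1.
Qed.

(* On unit spheres this metric relation says that, over the boundary points,
   [h] agrees with [f] wherever [f] is unimodular. *)
Definition dist2_le f h := forall g, unit_sphere A g ->
  sup_norm (f - g) = 2 -> sup_norm (h - g) = 2.

(** The test function is [- f x *: q] with [q] peaking at [x], inside a neighbourhood where [h]
    avoids the value [f x]. A point where [h] is opposite to it has [|q| = 1], hence [q = 1] by
    sharpening. There [h] takes the value [f x], yet the point lies in the neighbourhood. *)
Lemma dist2_le_eq f h x : unit_sphere A f -> unit_sphere A h -> dist2_le f h ->
  boundary_pt A x -> cabs (f x) = 1 -> h x = f x.
Proof.
move=> Sf Sh fh bx fx; apply: contrapT => hfx.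
have d0 : 0 < cabs (h x - f x).
  rewrite lt_neqAle cabs_ge0 andbT eq_sym; apply/eqP => h0; apply: hfx.
  by apply: subr0_eq; exact: cabs0_eq0.
have /continuous_cabsP/(_ x _ d0) Vx := algebra_continuous algA Sh.1.
have [p [pb px] pV] := bx _ Vx (2^-1) ltac:(lra).
pose q := sharpen p; have [_ p1] := pb.
have Sg : unit_sphere A (- f x *: q).
  apply: (@sphere_scale_peak _ _ x); first by rewrite cabsN.
    exact: unit_ball_sharpen.
  exact: sharpen_eq1.
have /fh : sup_norm (f - (- f x *: q)) = 2.
  apply/sphere_dist_eq2P => //; exists x; split=> //.
  by rewrite -[LHS]/(- f x * sharpen p x) sharpen_eq1 // mulr1.
move=> /(_ Sg)/(sphere_dist_eq2P Sh Sg)[y [hy]].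
rewrite fctE => gy.
have hyq : h y = f x * q y by rewrite -[LHS]opprK -gy -[- f x *: _]/(- f x * _) mulNr opprK.
have py : p y = 1.
  apply: contrapT => /eqP py; have := cabs_sharpen_lt1 (p1 y) py.
  by move: hy; rewrite hyq cabsM fx mul1r => ->; rewrite ltxx.
have Vy : cabs (h x - h y) < cabs (h x - f x).
  by apply: contrapT => Vy; have := pV _ Vy; rewrite py cabs1; lra.
by move: Vy; rewrite hyq /q (sharpen_eq1 py) mulr1 ltxx.
Qed.

Definition mean f g : X -> R[i]^o := 2^-1 *: (f + g).

Lemma mean_eq f g x : f x = g x -> mean f g x = f x.
Proof.
by move=> fg; rewrite -[LHS]/(2^-1 * (f x + g x)) -fg half_addzz.
Qed.

Lemma sphere_mean f g x : unit_sphere A f -> unit_sphere A g ->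
  cabs (f x) = 1 -> f x = g x -> unit_sphere A (mean f g).
Proof.
move=> Sf Sg fx fg; apply: (@sphere_intro _ x); last by rewrite mean_eq.
  by apply: algebraZ => //; apply: algebraD => //; [exact: Sf.1 | exact: Sg.1].
by move=> y; apply: cabs_half; exact: sphere_le1.
Qed.

(** Where the mean is unimodular, strict convexity makes [f] and [g] agree with it. *)
Lemma mean_dist2_le f g : unit_sphere A f -> unit_sphere A g ->
  unit_sphere A (mean f g) -> dist2_le (mean f g) f /\ dist2_le (mean f g) g.
Proof.
move=> Sf Sg Sm.
suff H h : unit_sphere A h -> sup_norm (mean f g - h) = 2 ->
    sup_norm (f - h) = 2 /\ sup_norm (g - h) = 2.
  by split=> h Sh /(H h Sh)[].
move=> Sh /(sphere_dist_eq2P Sm Sh)[x [mx hx]].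
have fg : f x = g x.
  apply: cabs_half_eq1; [exact: sphere_le1 | exact: sphere_le1 | by rewrite -mx].
move: mx hx; rewrite (mean_eq fg) => fx hx.
by split; apply/sphere_dist_eq2P => //; exists x; rewrite -?fg.
Qed.

Lemma separated_nbhs (y z : X) : y <> z -> exists V W : set X,
  [/\ nbhs y V, nbhs z W & forall w, V w -> ~ W w].
Proof.
move=> yz; have [_ _ _ sepA] := algA; have [_ [g [_ Ag _ gyz]]] := sepA y y z yz.
have d0 : 0 < cabs (g y - g z) / 2.
  apply: divr_gt0 => //; rewrite lt_neqAle cabs_ge0 andbT eq_sym.
  by apply: contra_neq gyz => h; apply: subr0_eq; exact: cabs0_eq0.
have /continuous_cabsP cg := algebra_continuous algA Ag.
exists [set w | cabs (g y - g w) < cabs (g y - g z) / 2].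
exists [set w | cabs (g z - g w) < cabs (g y - g z) / 2].
split; [exact: cg | exact: cg |] => w /= h1 h2.
by have := cabs_triangle (g y) (g z) (g w); rewrite (cabsB (g w)); lra.
Qed.

(** If [x] and [x'] differed, a function peaking at [x] and small at [x'] would lie in the first
    face but not in the second. *)
Lemma face_inj (x x' : X) (l l' : R[i]) : boundary_pt A x -> cabs l = 1 -> cabs l' = 1 ->
  (forall f, unit_sphere A f -> f x = l -> f x' = l') -> x = x' /\ l = l'.
Proof.
move=> bx l1 l1' H; have xx' : x = x'.
  apply: contrapT => /separated_nbhs[V [W [Vx Wx' VW]]].
  have [p [pb px] pV] := bx _ Vx (2^-1) ltac:(lra).
  have Vx' : ~ V x' by move=> /VW; apply; exact: nbhs_singleton.
  have := H _ (sphere_scale_peak l1 pb px); rewrite !fctE px => /(_ (mulr1 _)).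
  move=> /(congr1 (@cabs R)); rewrite cabsM l1 l1' mul1r => h.
  by have := pV _ Vx'; rewrite h; lra.
split=> //; have [p [pb px] _] := bx _ filterT 1 ltac:(lra).
have := H _ (sphere_scale_peak l1 pb px); rewrite -xx' !fctE px => /(_ (mulr1 _)) <-.
by rewrite -[_ *: _]/(l * 1) mulr1.
Qed.

End UnitSphere.

(** The inverse [D'] is carried along so that every result applies to both directions. *)
Definition sphere_isometry (R : realType) (X Y : topologicalType)
    (A : set (X -> R[i]^o)) (B : set (Y -> R[i]^o)) D D' :=
  [/\ forall f, unit_sphere A f -> unit_sphere B (D f) /\ D' (D f) = f,
      forall g, unit_sphere B g -> unit_sphere A (D' g) /\ D (D' g) = g &
      isometry_on (unit_sphere A) D].

Lemma sphere_isometry_sym (R : realType) (X Y : topologicalType)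
    (A : set (X -> R[i]^o)) (B : set (Y -> R[i]^o)) D D' :
  sphere_isometry A B D D' -> sphere_isometry B A D' D.
Proof.
move=> [SD SD' iD]; split=> // f g Sf Sg.
have [SDf Df] := SD' f Sf; have [SDg Dg] := SD' g Sg.
by rewrite -iD // Df Dg.
Qed.

Definition face_corr (R : realType) (X Y : topologicalType)
    (A : set (X -> R[i]^o)) (B : set (Y -> R[i]^o)) D (x : X) (l : R[i]) (y : Y) (m : R[i]) :=
  [/\ boundary_pt A x, boundary_pt B y, cabs l = 1, cabs m = 1 &
      forall f, unit_sphere A f -> (f x = l <-> D f y = m)].

(** * Action of a sphere isometry on faces *)

Section FaceCorrespondence.
Variables (R : realType) (X Y : topologicalType).
Variables (A : set (X -> R[i]^o)) (B : set (Y -> R[i]^o)).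
Hypotheses (algA : uniformly_closed_function_algebra A)
  (algB : uniformly_closed_function_algebra B).
Variables (D : (X -> R[i]^o) -> (Y -> R[i]^o)) (D' : (Y -> R[i]^o) -> (X -> R[i]^o)).
Hypothesis isoD : sphere_isometry A B D D'.
Implicit Types (f g : X -> R[i]^o).

Lemma face_corr_sym x l y m : face_corr A B D x l y m -> face_corr B A D' y m x l.
Proof.
case: isoD => _ SD' _ [bx by_ l1 m1 H]; split=> // g /SD'[SD'g Dg].
by rewrite (H _ SD'g) Dg.
Qed.

Lemma dist2_le_image f h : unit_sphere A f -> unit_sphere A h ->
  dist2_le A f h -> dist2_le B (D f) (D h).
Proof.
case: isoD => _ SD' iD Sf Sh fh g /SD'[SD'g Dg].
by rewrite -Dg !iD //; exact: fh.
Qed.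

(* Midpoints show that finitely many images of elements of a face share a
   boundary point; compactness and [peak_set_boundary] extend this to all. *)
Lemma face_image f0 x : unit_sphere A f0 -> cabs (f0 x) = 1 ->
  exists y m, [/\ boundary_pt B y, cabs m = 1 &
    forall f, unit_sphere A f -> f x = f0 x -> D f y = m].
Proof.
move=> Sf0 f01; have [SD _ _] := isoD.
have SDb f : unit_sphere A f -> unit_sphere B (D f) by case/SD.
pose F := {f | unit_sphere A f /\ f x = f0 x}.
(* For two members of the face, the set [E] of their mean lies in both of theirs, which gives
   directedness. It is not empty because the image of the mean with [f0] attains its norm at a
   boundary point. *)
pose E (f : F) := [set y | [/\ boundary_pt B y, cabs (D f0 y) = 1 & D (sval f) y = D f0 y]].
pose i0 : F := exist _ f0 (conj Sf0 erefl).
have meanP f g : unit_sphere A f -> unit_sphere A g -> f x = f0 x -> g x = f0 x ->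
    [/\ unit_sphere A (mean f g), mean f g x = f0 x &
    forall y, boundary_pt B y -> cabs (D (mean f g) y) = 1 ->
      D f y = D (mean f g) y /\ D g y = D (mean f g) y].
  move=> Sf Sg fx gx; have fg : f x = g x by rewrite fx gx.
  have Sm : unit_sphere A (mean f g) by apply: (@sphere_mean _ _ _ algA _ _ x); rewrite ?fx.
  split=> //; first by rewrite mean_eq.
  move=> y by_ my; have [mf mg] := mean_dist2_le algA Sf Sg Sm.
  by split; apply: (dist2_le_eq algB) => //; try exact: SDb; exact: dist2_le_image.
have cC : compact [set y | 1 <= cabs (D f0 y)].
  by have [_ h] := algebra_C0 algB (SDb _ Sf0).1; exact: h.
have [|||y /= y1 hy] := @compact_directed_closure _ _ _ i0 E cC.
- move=> [f [Sf fx]]; have [Sm mx mE] := meanP f f0 Sf Sf0 fx erefl.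
  have [BDm Dm1] := SDb _ Sm.
  have [y by_] := norm_attained_boundary algB BDm ltac:(rewrite Dm1; lra).
  rewrite Dm1 => my; have [e1 e2] := mE y by_ my.
  by exists y; split=> //=; rewrite ?e1 e2.
- by move=> f y [_ y1 _] /=; rewrite y1.
- move=> [f [Sf fx]] [g [Sg gx]]; have [Sm mx mE] := meanP f g Sf Sg fx gx.
  pose k : F := exist _ (mean f g) (conj Sm mx); exists k => y [by_ y1 /= my].
  by have [e1 e2] := mE y by_ ltac:(by rewrite my); split; split=> //=; rewrite ?e1 ?e2.
have {}hy f : unit_sphere A f -> f x = f0 x -> D f y = D f0 y.
  move=> Sf fx; apply: subr0_eq.
  have ABf := algebraB algB (SDb _ Sf).1 (SDb _ Sf0).1.
  apply: (@closed_eq_fun _ _ _ 0 (algebra_continuous algB ABf) y).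
  apply: closure_subset (hy (exist _ f (conj Sf fx) : F)) => z [_ _ /= e].
  by rewrite !fctE e subrr.
have Dy1 : cabs (D f0 y) = 1.
  by apply/eqP; rewrite eq_le y1 andbT; apply: (sphere_le1 algB); exact: SDb.
have Dy0 : D f0 y != 0 by apply/eqP => h; move: Dy1; rewrite h cabs0; lra.
(* The cluster point [y] need not be a boundary point, but it lies in the peak set of the normalized
   images, which therefore contains one. *)
pose S := [set p | exists2 f, unit_sphere A f /\ f x = f0 x & p = (D f0 y)^-1 *: D f].
have [|||y' by_ y'S] := @peak_set_boundary _ _ _ algB S ((D f0 y)^-1 *: D f0) y.
- move=> _ [f [Sf fx] ->]; split; first by apply: algebraZ => //; exact: (SDb _ Sf).1.
  by move=> z; rewrite fctE cabsM cabsV Dy1 invr1 mul1r; apply: (sphere_le1 algB); exact: SDb.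
- by exists f0.
- by move=> _ [f [Sf fx] ->]; rewrite fctE hy //; exact: mulVf.
exists y', (D f0 y); split=> // f Sf fx.
have h : (D f0 y)^-1 * D f y' = 1 by apply: (y'S ((D f0 y)^-1 *: D f)); exists f.
by rewrite -[LHS](mulVKf Dy0) h mulr1.
Qed.

(* The face at [x] opposite to [f x] lies at distance at least [1 + |f x|] from
   [f]; in [B], functions sharply peaked at [y] attain that distance only if
   [m] is opposite to [D f y]. *)
Lemma value_at_opposite_face x l y m f : face_corr A B D x l y m -> unit_sphere A f ->
  f x != 0 -> l = - (f x / (cabs (f x))%:C) ->
  cabs (f x) <= cabs (D f y) /\
  (cabs (D f y) <= cabs (f x) -> D f y = - ((cabs (f x))%:C * m)).
Proof.
move=> [bx by_ l1 m1 H] Sf fx0 lE; have [SD SD' iD] := isoD.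
have [SDf _] := SD f Sf.
set r := cabs (f x); set b := D f y.
have r0 : 0 < r by rewrite lt_neqAle cabs_ge0 andbT eq_sym; apply: contra_neq fx0; exact: cabs0_eq0.
have r1 : r <= 1 by exact: (sphere_le1 algA).
have fxl : f x = - (r%:C * l).
  by rewrite lE mulrN opprK mulrC divfK // cabsC_neq0.
(* Here [p] is the value of a peaking function at a point where the distance from [D f] to its
   sharpened multiple is attained. As [e <= r], that point cannot lie outside the neighbourhood, so
   [D f] is within [e] of [b] there. *)
have key (e : R) : 0 < e -> e <= r -> exists2 p : R[i], cabs p <= 1 &
    1 + r - e <= cabs (b - m * (2^-1 * (p + p ^+ 2))).
  move=> e0 er.
  have /continuous_cabsP/(_ y e e0) Vy := algebra_continuous algB SDf.1.
  have [p [pb py] pV] := by_ _ Vy e e0.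
  have [_ p1] := pb; have qb := unit_ball_sharpen algB pb.
  have Sg : unit_sphere B (m *: sharpen p).
    by apply: (sphere_scale_peak algB m1 qb (x := y)); exact: sharpen_eq1.
  have [SD'g D'g] := SD' _ Sg.
  have D'gx : D' (m *: sharpen p) x = l.
    apply/H => //; rewrite D'g fctE sharpen_eq1 //; exact: mulr1.
  have fgB := algebraB algB SDf.1 Sg.1.
  have dist : 1 + r <= sup_norm (D f - m *: sharpen p).
    rewrite -{1}D'g iD //.
    have := le_sup_norm x (algebra_C0 algA (algebraB algA Sf.1 SD'g.1)).
    rewrite !fctE D'gx fxl -opprD cabsN -[X in _ + X]mul1r -mulrDl cabsM l1 mulr1.
    by rewrite -(rmorph1 (real_complex R)) -rmorphD /= cabs_real ger0_norm; lra.
  have [w hw] := sup_norm_attained (algebra_C0 algB fgB) ltac:(lra).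
  move: dist; rewrite -hw => {}hw.
  have qE : sharpen p w = 2^-1 * (p w + p w ^+ 2) by rewrite expr2.
  have Dfw := sphere_le1 algB w SDf.
  have qw : cabs (sharpen p w) <= cabs (p w).
    rewrite qE expr2 cabsM cabs2V; have := cabsD (p w) (p w * p w); rewrite cabsM.
    by have := cabs_ge0 (p w); have := p1 w; nra.
  have gw : (D f - m *: sharpen p) w = D f w - m * sharpen p w by [].
  have Vw : cabs (D f y - D f w) < e.
    apply: contrapT => /pV pw; move: hw; rewrite gw.
    have := cabsD (D f w) (- (m * sharpen p w)); rewrite cabsN cabsM m1 mul1r; lra.
  exists (p w) => //; rewrite -qE.
  have := cabs_triangle (D f w) (m * sharpen p w) b.
  by rewrite (cabsB _ b); move: hw Vw; rewrite gw -/b; lra.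
split.
  apply/ler_addgt0Pr => e e0.
  have [p p1] := key (Num.min e r) ltac:(by rewrite lt_min e0)
    ltac:(by rewrite ge_min lexx orbT).
  have me : Num.min e r <= e by rewrite ge_min lexx.
  have q1 : cabs (2^-1 * (p + p ^+ 2)) <= 1 by apply: cabs_half => //; exact: cabsM_le1.
  by have := cabsD b (- (m * (2^-1 * (p + p ^+ 2)))); rewrite cabsN cabsM m1 mul1r; lra.
move=> br.
have m0 : m != 0 by apply/eqP => h; move: m1; rewrite h cabs0; lra.
have rC0 : r%:C != 0 by exact: cabsC_neq0.
(* The claim becomes [u = 1]. Tolerance [r * d] in [key] turns into [d] for [|u + q|], after the
   remainder [(1 - r) * q] is split off and a factor [r] is cancelled. *)
pose u := - (b / (r%:C * m)).
have bu : b = - (r%:C * m * u).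
  by rewrite /u mulrN opprK mulrC divfK // mulf_neq0.
have u1 : cabs u <= 1.
  by rewrite cabsN cabsM cabsV cabsM m1 mulr1 cabs_real gtr0_norm // ler_pdivrMr // mul1r.
suff uE : u = 1 by rewrite bu uE mulr1.
apply: peak_alignment => // d d0.
have rd : 0 < r * d by rewrite mulr_gt0.
have [p p1] := key (Num.min (r * d) r) ltac:(by rewrite lt_min rd)
  ltac:(by rewrite ge_min lexx orbT).
have me : Num.min (r * d) r <= r * d by rewrite ge_min lexx.
set q := 2^-1 * _ => hq; exists p => //; rewrite -/q.
have q1 : cabs q <= 1 by apply: cabs_half => //; exact: cabsM_le1.
have : cabs (b - m * q) <= r * cabs (u + q) + (1 - r) * 1.
  have -> : b - m * q = - (m * (r%:C * (u + q) + (1 - r)%:C * q)).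
    by rewrite bu rmorphB rmorph1; ring.
  rewrite cabsN cabsM m1 mul1r; apply: le_trans (cabsD _ _) _.
  rewrite (cabsM r%:C) (cabsM (1 - r)%:C) !cabs_real (gtr0_norm r0) ger0_norm; last lra.
  by rewrite lerD2l ler_wpM2l //; lra.
nra.
Qed.

End FaceCorrespondence.

(** * The induced map of boundary points and the extension *)

Section FaceCorrespondencePoints.
Variables (R : realType) (X Y : topologicalType).
Variables (A : set (X -> R[i]^o)) (B : set (Y -> R[i]^o)).
Hypotheses (algA : uniformly_closed_function_algebra A)
  (algB : uniformly_closed_function_algebra B).
Variables (D : (X -> R[i]^o) -> (Y -> R[i]^o)) (D' : (Y -> R[i]^o) -> (X -> R[i]^o)).
Hypothesis isoD : sphere_isometry A B D D'.

(** [face_image] for [D] and then for [D'] sends the face into a face over [X] that contains it; by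
    [face_inj] the two coincide, so both inclusions are equalities. *)
Lemma exists_face_corr x (l : R[i]) : boundary_pt A x -> cabs l = 1 ->
  exists y m, face_corr A B D x l y m.
Proof.
move=> bx l1; have [SD SD' _] := isoD.
have [p [pb px] _] := bx _ filterT 1 ltac:(lra).
have lpx : (l *: p) x = l by rewrite fctE px; exact: mulr1.
have [|y [m [by_ m1 Hy]]] := face_image (x := x) algA algB isoD (sphere_scale_peak algA l1 pb px).
  by rewrite lpx.
rewrite lpx in Hy.
have [q [qb qy] _] := by_ _ filterT 1 ltac:(lra).
have mqy : (m *: q) y = m by rewrite fctE qy; exact: mulr1.
have [|x' [l' [bx' l1' Hx]]] :=
  face_image (x := y) algB algA (sphere_isometry_sym isoD) (sphere_scale_peak algB m1 qb qy).
  by rewrite mqy.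
rewrite mqy in Hx.
have [xx' ll'] : x = x' /\ l = l'.
  apply: (face_inj algA bx l1 l1') => f Sf fx; have [SDf <-] := SD f Sf.
  by apply: Hx => //; exact: Hy.
exists y, m; split=> // f Sf; split; first exact: Hy.
by have [SDf {2}<-] := SD f Sf; rewrite xx' ll'; exact: Hx.
Qed.

(** For distinct [y] and [y'], functions peaking there and at most [1 / 8] off disjoint
    neighbourhoods are at distance at most [9 / 8], while their preimages differ by [l - l'] at
    [x]. *)
Lemma face_corr_far x l l' y y' m m' : 9 / 8 < cabs (l - l') ->
  face_corr A B D x l y m -> face_corr A B D x l' y' m' -> y = y'.
Proof.
move=> ll' [bx by_ l1 m1 H] [_ by' l1' m1' H']; have [_ SD' iD] := isoD.
apply: contrapT => /(separated_nbhs algB)[V [W [Vy Wy' VW]]].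
have [p [pb py] pV] := by_ _ Vy (1 / 8) ltac:(lra).
have [q [qb qy] qW] := by' _ Wy' (1 / 8) ltac:(lra).
have Su := sphere_scale_peak algB m1 pb py.
have Sv := sphere_scale_peak algB m1' qb qy.
have [SD'u Du] := SD' _ Su; have [SD'v Dv] := SD' _ Sv.
have ux : D' (m *: p) x = l by apply/H; rewrite // Du fctE py; exact: mulr1.
have vx : D' (m' *: q) x = l' by apply/H'; rewrite // Dv fctE qy; exact: mulr1.
have := le_sup_norm x (algebra_C0 algA (algebraB algA SD'u.1 SD'v.1)).
have -> : (D' (m *: p) - D' (m' *: q)) x = l - l' by rewrite -ux -vx.
rewrite -iD // Du Dv => h.
suff : sup_norm (m *: p - m' *: q) <= 9 / 8 by lra.
apply: sup_norm_le => [|w]; first lra.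
have -> : (m *: p - m' *: q) w = m * p w - m' * q w by [].
have := cabsD (m * p w) (- (m' * q w)); rewrite cabsN !cabsM m1 m1' !mul1r.
have := pb.2 w; have := qb.2 w.
have [/VW/qW|/pV] := pselect (V w); lra.
Qed.

(** When [l] and [l'] are too close for a direct comparison, [- l'] is far from both and serves as
    an intermediate label. *)
Lemma face_corr_point x l l' y y' m m' :
  face_corr A B D x l y m -> face_corr A B D x l' y' m' -> y = y'.
Proof.
move=> H H'; have [bx _ l1 _ _] := H; have [_ _ l1' _ _] := H'.
have [ll'|ll'] := cabs_sub_or_add l1 l1'; first exact: face_corr_far H H'.
have [y2 [m2 H2]] := @exists_face_corr x (- l') bx ltac:(by rewrite cabsN).
rewrite (face_corr_far _ H H2) ?opprK //; apply: (face_corr_far _ H2 H').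
by rewrite -opprD cabsN cabs_double l1'; lra.
Qed.

(** Multiples of one peaking function by [m] and [m'] are at distance at most [|m - m'|], and their
    preimages take the values [l] and [l'] at [x]. *)
Lemma face_corr_dist_le x l l' y m m' :
  face_corr A B D x l y m -> face_corr A B D x l' y m' -> cabs (l - l') <= cabs (m - m').
Proof.
move=> [bx by_ l1 m1 H] [_ _ l1' m1' H']; have [_ SD' iD] := isoD.
have [p [pb py] _] := by_ _ filterT 1 ltac:(lra).
have Su := sphere_scale_peak algB m1 pb py.
have Sv := sphere_scale_peak algB m1' pb py.
have [SD'u Du] := SD' _ Su; have [SD'v Dv] := SD' _ Sv.
have ux : D' (m *: p) x = l by apply/H; rewrite // Du fctE py; exact: mulr1.
have vx : D' (m' *: p) x = l' by apply/H'; rewrite // Dv fctE py; exact: mulr1.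
have := le_sup_norm x (algebra_C0 algA (algebraB algA SD'u.1 SD'v.1)).
have -> : (D' (m *: p) - D' (m' *: p)) x = l - l' by rewrite -ux -vx.
rewrite -iD // Du Dv => /le_trans; apply.
apply: sup_norm_le => [|w]; first exact: cabs_ge0.
have -> : (m *: p - m' *: p) w = (m - m') * p w by rewrite mulrBl.
by rewrite cabsM ler_piMr ?cabs_ge0 //; exact: pb.2.
Qed.

End FaceCorrespondencePoints.

Section PointwiseForm.
Variables (R : realType) (X Y : topologicalType).
Variables (A : set (X -> R[i]^o)) (B : set (Y -> R[i]^o)).
Hypotheses (algA : uniformly_closed_function_algebra A)
  (algB : uniformly_closed_function_algebra B).
Variables (D : (X -> R[i]^o) -> (Y -> R[i]^o)) (D' : (Y -> R[i]^o) -> (X -> R[i]^o)).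
Hypothesis isoD : sphere_isometry A B D D'.

(** The estimate is known for the label opposite to [f x], and the point [y] is the same for all
    labels. *)
Lemma face_corr_value_le x l y m f : face_corr A B D x l y m -> unit_sphere A f ->
  cabs (f x) <= cabs (D f y).
Proof.
move=> H Sf; have [bx _ _ _ _] := H.
have [->|fx0] := eqVneq (f x) 0; first by rewrite cabs0 cabs_ge0.
have [y' [m' H']] := exists_face_corr algA algB isoD bx (cabs_unit_part fx0).
rewrite (face_corr_point algA algB isoD H H').
by have [] := value_at_opposite_face algA algB isoD H' Sf fx0 erefl.
Qed.

End PointwiseForm.

Section Normalization.
Variables (R : realType) (X : topologicalType) (A : set (X -> R[i]^o)).
Hypothesis algA : uniformly_closed_function_algebra A.

Lemma sup_norm_eq0 f : A f -> sup_norm f = 0 -> f = 0.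
Proof.
move=> Af f0; apply/funext => x; apply: cabs0_eq0; apply/eqP; rewrite eq_le cabs_ge0 andbT.
by rewrite -f0; apply: le_sup_norm; exact: algebra_C0 Af.
Qed.

Lemma sphere_normalize f : A f -> sup_norm f != 0 ->
  unit_sphere A ((sup_norm f)^-1%:C *: f).
Proof.
move=> Af f0; have fC := algebra_C0 algA Af.
have fpos : 0 < sup_norm f by rewrite lt_neqAle eq_sym f0 sup_norm_ge0.
have scE z : cabs (((sup_norm f)^-1%:C *: f) z) = cabs (f z) / sup_norm f.
  by rewrite fctE cabsM cabs_real gtr0_norm ?invr_gt0 // mulrC.
have [x fx] := sup_norm_attained fC fpos.
apply: (@sphere_intro _ _ _ algA _ x); first exact: algebraZ.
- by move=> z; rewrite scE ler_pdivrMr // mul1r le_sup_norm.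
- by rewrite scE fx mulfV.
Qed.

End Normalization.

(** * Homogeneous extension of the sphere isometry *)

Section Extension.
Variables (R : realType) (X Y : topologicalType).
Variables (A : set (X -> R[i]^o)) (B : set (Y -> R[i]^o)).
Hypotheses (algA : uniformly_closed_function_algebra A)
  (algB : uniformly_closed_function_algebra B).
Variables (D : (X -> R[i]^o) -> (Y -> R[i]^o)) (D' : (Y -> R[i]^o) -> (X -> R[i]^o)).
Hypothesis isoD : sphere_isometry A B D D'.

Lemma face_corr_value x l y m : face_corr A B D x l y m ->
  exists2 t : R[i], cabs t = 1 &
    (forall f, unit_sphere A f -> D f y = t * f x) \/
    (forall f, unit_sphere A f -> D f y = t * conjc (f x)).
Proof.
move=> H; have [bx by_ l1 m1 _] := H; have [SD SD' _] := isoD.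
have iso' := sphere_isometry_sym isoD.
(* The condition on [k] sits under the existential so that [choice] gives a total [tau]; off the
   circle its value is an arbitrary 0. *)
have ex k : exists m', cabs k = 1 -> face_corr A B D x k y m'.
  have [k1|k1] := pselect (cabs k = 1); last by exists 0.
  have [y' [m' H']] := exists_face_corr algA algB isoD bx k1.
  by exists m'; rewrite (face_corr_point algA algB isoD H H').
have [tau tauP] := choice ex.
have tau1 k : cabs k = 1 -> cabs (tau k) = 1 by move=> /tauP[].
have tauB k k' : cabs k = 1 -> cabs k' = 1 -> cabs (tau k - tau k') = cabs (k - k').
  move=> /tauP Hk /tauP Hk'; apply/eqP; rewrite eq_le.
  rewrite (face_corr_dist_le algA algB isoD Hk Hk') andbT.
  exact: (face_corr_dist_le algB algA iso' (face_corr_sym isoD Hk) (face_corr_sym isoD Hk')).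
have val f : unit_sphere A f ->
    D f y = (cabs (f x))%:C * (- tau (- (f x / (cabs (f x))%:C))).
  move=> Sf; have [SDf DDf] := SD f Sf.
  (* The bound for the inverse, applied to [D f], supplies the inequality that
     [value_at_opposite_face] needs for the exact value. *)
  have le2 : cabs (D f y) <= cabs (f x).
    by have := face_corr_value_le algB algA iso' (face_corr_sym isoD H) SDf; rewrite DDf.
  have [fx0|fx0] := eqVneq (f x) 0.
    rewrite fx0 cabs0 mul0r; apply: cabs0_eq0; apply/eqP; rewrite eq_le cabs_ge0 andbT.
    by move: le2; rewrite fx0 cabs0.
  have k1 := cabs_unit_part fx0.
  rewrite mulrN.
  by apply: (value_at_opposite_face algA algB isoD (tauP _ k1) Sf fx0 erefl).2.
have [tauE|tauE] := circle_isometry tau1 tauB; exists (tau 1); rewrite ?tau1 ?cabs1 //.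
- left=> f Sf; rewrite val //.
  have [fx0|fx0] := eqVneq (f x) 0; first by rewrite fx0 cabs0 mul0r mulr0.
  by rewrite tauE; [exact: polar_mul | exact: cabs_unit_part].
- right=> f Sf; rewrite val //.
  have [fx0|fx0] := eqVneq (f x) 0; first by rewrite (conjc0_eq fx0) fx0 cabs0 mul0r mulr0.
  by rewrite tauE; [exact: polar_mul_conj | exact: cabs_unit_part].
Qed.

Lemma sphere_isometry_extension :
  exists T : (X -> R[i]^o) -> (Y -> R[i]^o),
    [/\ set_fun A B T,
        set_surj A B T,
        real_linear_on A T,
        isometry_on A T &
        forall f, unit_sphere A f -> T f = D f].
Proof.
have [SD SD' _] := isoD.
(* For norm 0 the argument of [D] is off the sphere, where nothing is known, but the leading factor
   0 makes the result 0. *)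
pose T (f : X -> R[i]^o) : Y -> R[i]^o := (sup_norm f)%:C *: D ((sup_norm f)^-1%:C *: f).
have TB f : A f -> B (T f).
  move=> Af; have [f0|f0] := eqVneq (sup_norm f) 0.
    rewrite /T f0 scale0r; exact: (algebra0 algB).
  by apply: algebraZ => //; exact: (SD _ (sphere_normalize algA Af f0)).1.1.
have TD f : unit_sphere A f -> T f = D f.
  by move=> [_ f1]; rewrite /T f1 invr1 !scale1r.
(* The factor [t] and the choice between [f x] and its conjugate may vary with the pair of points;
   both forms are real linear and preserve distances. *)
pose form (x : X) (y : Y) := exists2 t : R[i], cabs t = 1 &
  (forall f, A f -> T f y = t * f x) \/ (forall f, A f -> T f y = t * conjc (f x)).
have face_form x l y m : face_corr A B D x l y m -> form x y.
  have scal (r : R) (c : R[i]) t : r != 0 -> r%:C * (t * (r^-1%:C * c)) = t * c.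
    by move=> r0; rewrite mulrCA [r%:C * _]mulrA -rmorphM /= mulfV // rmorph1 mul1r.
  have Tf0 f : A f -> sup_norm f = 0 -> T f y = 0 /\ f x = 0.
    by move=> Af f0; rewrite /T f0 scale0r (sup_norm_eq0 algA Af f0).
  move=> /face_corr_value[t t1 H]; exists t => //; case: H => H; [left|right] => f Af.
  - have [f0|f0] := eqVneq (sup_norm f) 0; first by have [-> ->] := Tf0 f Af f0; rewrite mulr0.
    rewrite /T fctE H; last exact: (sphere_normalize algA).
    exact: scal.
  - have [f0|f0] := eqVneq (sup_norm f) 0.
      by have [-> /conjc0_eq ->] := Tf0 f Af f0; rewrite mulr0.
    rewrite /T fctE H; last exact: (sphere_normalize algA).
    rewrite [conjc _](_ : _ = (sup_norm f)^-1%:C * conjc (f x)); first exact: scal.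
    exact: conjc_realM.
have formX x : boundary_pt A x -> exists y, form x y.
  move=> bx; have [y [m /face_form]] := exists_face_corr algA algB isoD bx (cabs1 R).
  by exists y.
(* Matching every boundary point of [B] requires the inverse isometry. Linearity and one norm
   inequality rest on this, the other inequality on [formX]. *)
have formY y : boundary_pt B y -> exists x, form x y.
  move=> by_; have iso' := sphere_isometry_sym isoD.
  have [x [m /(face_corr_sym iso')/face_form]] := exists_face_corr algB algA iso' by_ (cabs1 R).
  by exists x.
have Tlin : real_linear_on A T.
  split=> [f g Af Ag | r f Af]; apply: (eq_on_boundary algB).
  - by apply: TB; exact: algebraD.
  - by apply: algebraD => //; exact: TB.
  - have Afg := algebraD algA Af Ag; move=> y /formY[x [t _ [] TE]].
      by rewrite -[RHS]/(T f y + T g y) !TE // -mulrDr.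
    by rewrite -[RHS]/(T f y + T g y) !TE // -mulrDr -rmorphD.
  - by apply: TB; exact: algebraZ.
  - by apply: algebraZ => //; exact: TB.
  - have Arf := algebraZ algA r%:C Af; move=> y /formY[x [t _ [] TE]].
      by rewrite -[RHS]/(r%:C * T f y) !TE // mulrCA.
    by rewrite -[RHS]/(r%:C * T f y) !TE // mulrCA -conjc_realM.
have form_dist x y f g : form x y -> A f -> A g -> cabs ((T f - T g) y) = cabs ((f - g) x).
  move=> [t t1 [] TE] Af Ag; rewrite !fctE !TE // -mulrBr cabsM t1 mul1r //.
  by rewrite -rmorphB cabs_conj.
have Tiso : isometry_on A T.
  move=> f g Af Ag; have Afg := algebraB algA Af Ag.
  have BTfg := algebraB algB (TB _ Af) (TB _ Ag).
  have fgC := algebra_C0 algA Afg; have TfgC := algebra_C0 algB BTfg.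
  apply/eqP; rewrite eq_le; apply/andP; split; rewrite leNgt; apply/negP => h.
  - have [|y /formY[x xy] Ey] := norm_attained_boundary algB BTfg.
      by apply: le_lt_trans h; exact: sup_norm_ge0.
    by move: h; rewrite -Ey (form_dist _ _ _ _ xy) // ltNge le_sup_norm.
  - have [|x /formX[y xy] Ex] := norm_attained_boundary algA Afg.
      by apply: le_lt_trans h; exact: sup_norm_ge0.
    by move: h; rewrite -Ex -(form_dist _ _ _ _ xy) // ltNge le_sup_norm.
exists T; split=> //.
move=> g Bg; have [g0|g0] := eqVneq (sup_norm g) 0.
  have A0 := algebra0 algA; exists (fun=> 0) => //.
  have T0 : T (fun=> 0) = 0.
    rewrite -[fun=> 0]/(0 : X -> R[i]^o) -(scale0r (0 : X -> R[i]^o)).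
    by rewrite -(rmorph0 (real_complex R)) Tlin.2 // rmorph0 scale0r.
  by rewrite T0; apply/esym; apply/funext => y; rewrite (sup_norm_eq0 algB Bg g0).
(* A preimage of [g] is found by normalizing, pulling back along [D'] and rescaling. *)
have [SD'g Dg] := SD' _ (sphere_normalize algB Bg g0).
exists ((sup_norm g)%:C *: D' ((sup_norm g)^-1%:C *: g)); first by apply: algebraZ; case: SD'g.
by rewrite Tlin.2 ?TD // ?Dg ?scalerA -?rmorphM /= ?mulfV // ?scale1r //; case: SD'g.
Qed.

End Extension.

Unset Implicit Arguments.

Theorem theorem2p1 (R : realType) (X Y : topologicalType)
    (hausdorffX : hausdorff_space X) (lcX : locally_compact [set: X])
    (hausdorffY : hausdorff_space Y) (lcY : locally_compact [set: Y])
    (A : set (X -> R[i]^o)) (B : set (Y -> R[i]^o))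
    (algA : uniformly_closed_function_algebra A)
    (algB : uniformly_closed_function_algebra B)
    (Delta : (X -> R[i]^o) -> (Y -> R[i]^o))
    (Delta_fun : set_fun (unit_sphere A) (unit_sphere B) Delta)
    (Delta_surj : set_surj (unit_sphere A) (unit_sphere B) Delta)
    (Delta_isometry : isometry_on (unit_sphere A) Delta) :
  exists T : (X -> R[i]^o) -> (Y -> R[i]^o),
    [/\ set_fun A B T,
        set_surj A B T,
        real_linear_on A T,
        isometry_on A T &
        forall f, unit_sphere A f -> T f = Delta f].
Proof.
(* Off the sphere of [B] the preimage defaults to the zero function, which makes [choice]
   applicable. *)
have surj g : exists f, unit_sphere B g -> unit_sphere A f /\ Delta f = g.
  have [/Delta_surj[f Sf Df]|nSg] := pselect (unit_sphere B g); first by exists f.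
  by exists (fun=> 0).
have [D' D'P] := choice surj.
apply: (sphere_isometry_extension algA algB (D' := D')); split=> // f Sf.
have SDf := Delta_fun _ Sf; split=> //; have [SD' DD'] := D'P _ SDf.
(* The chosen right inverse is also a left inverse: [D' (Delta f)] and [f] have the same image, so
   their distance is 0. *)
apply: subr0_eq; apply: (sup_norm_eq0 algA).
  by apply: (algebraB algA); [exact: SD'.1 | exact: Sf.1].
rewrite -Delta_isometry // DD' subrr; apply/eqP; rewrite eq_le.
rewrite sup_norm_ge0 ?andbT; last exact: algebra_C0 (algebra0 algB).
by rewrite sup_norm_le // => y; rewrite cabs0.
Qed.
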